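(* Let $m_1,m_2$ be real numbers with $0<m_1<m_2<\infty$ and let $m:[0,1]\to[m_1,m_2]$ be continuous (not necessarily differentiable). For a differentiable function $y:[0,1]\to[0,1]$ put $$J[y]=\int_0^1 m(y(x))\,(y'(x))^2\,dx ,$$ and let $F(y)=\int_0^y \sqrt{m(s)}\,ds$ for $y\in[0,1]$. Then the solution $y^*:[0,1]\to[0,1]$ given implicitly by $$y^*(x)=\frac{\int_0^x m(y^*(s))^{-1/2}\,ds}{\int_0^1 m(y^*(s))^{-1/2}\,ds}\qquad (x\in[0,1]),$$ and the solution $y^*$ given explicitly by inverting $F$ in $$F(y^*(x))=F(1)\,x\qquad (x\in[0,1]),$$ globally minimize $J$ among all differentiable functions $y$ satisfying $y(0)=0$ and $y(1)=1$; that is, $J[y^*]\le J[y]$ for every such $y$.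
   Context: Here $m(s)^{-1/2}$ denotes $1/\sqrt{m(s)}$. The competitors $y$ take values in $[0,1]$, the domain of $m$, so that $J[y]$ is defined. *)

(* Defs.v *)
From HB Require Import structures.
From mathcomp Require Import all_boot all_order all_algebra.
From mathcomp Require Import all_classical all_reals all_analysis.

Set Implicit Arguments.
Unset Strict Implicit.
Unset Printing Implicit Defensive.

Import Order.TTheory GRing.Theory Num.Theory.
Import numFieldNormedType.Exports.

Local Open Scope classical_set_scope.
Local Open Scope ring_scope.

(* A function on [0,1] is represented by a function R -> R; every notion below
   depends only on its values on [0,1]. *)

Definition maps01 (R : realType) (y : R -> R) : Prop :=
  {in `[0, 1], forall x, y x \in `[0, 1]}.

(* Differentiability and derivative relative to [0,1]: the difference quotient
   is taken along z -> x with z in [0,1], z != x, so it is one-sided at 0 and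
   at 1. *)
Definition derivable01 (R : realType) (y : R -> R) (x : R) : Prop :=
  cvg ((y z - y x) / (z - x) @[z --> within `[0, 1] x^']).

Definition derive01 (R : realType) (y : R -> R) (x : R) : R :=
  lim ((y z - y x) / (z - x) @[z --> within `[0, 1] x^']).

(* Extended-real-valued Lebesgue integral: J m y is +oo when m(y) y'^2, which is
   nonnegative, is not integrable (y' may be unbounded). *)
Definition J (R : realType) (m y : R -> R) : \bar R :=
  (\int[lebesgue_measure]_(x in `[0%R, 1%R]) (m (y x) * derive01 y x ^+ 2)%:E)%E.

Definition F (R : realType) (m : R -> R) (y : R) : R :=
  \int[lebesgue_measure]_(s in `[0, y]) Num.sqrt (m s).

Definition competitor (R : realType) (y : R -> R) : Prop :=
  [/\ maps01 y, {in `[0, 1], forall x, derivable01 y x}, y 0 = 0 & y 1 = 1].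

Definition global_minimizer (R : realType) (m ystar : R -> R) : Prop :=
  competitor ystar /\ forall y, competitor y -> (J m ystar <= J m y)%E.

Definition implicit_solution (R : realType) (m y : R -> R) : Prop :=
  maps01 y /\
  {in `[0, 1], forall x,
     y x = (\int[lebesgue_measure]_(s in `[0, x]) (Num.sqrt (m (y s)))^-1) /
           (\int[lebesgue_measure]_(s in `[0, 1]) (Num.sqrt (m (y s)))^-1)}.

Definition explicit_solution (R : realType) (m y : R -> R) : Prop :=
  maps01 y /\ {in `[0, 1], forall x, F m (y x) = F m 1 * x}.

(* Existence and uniqueness as a function on [0,1]. *)
Definition exists_unique01 (R : realType) (P : (R -> R) -> Prop) : Prop :=
  exists y, P y /\ forall z, P z -> {in `[0, 1], z =1 y}.

(* Main.v *)
Require Import Defs.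
From HB Require Import structures.
From mathcomp Require Import all_boot all_order all_algebra.
From mathcomp Require Import all_classical all_reals all_analysis.
From mathcomp Require Import measurable_realfun ring lra.

Import Order.TTheory GRing.Theory Num.Theory.
Import numFieldNormedType.Exports.

Local Open Scope classical_set_scope.
Local Open Scope ring_scope.

(** Write L for F(1). In the coordinate u = F(y) the functional becomes
    J[y] = int (u')^2, because u' = sqrt(m(y)) y', and u runs from 0 to L. The
    elementary inequality (u' - L)^2 >= 0, that is
    2 L u' <= m(y) y'^2 + L^2, integrates to
    2 L (u(1) - u(0)) <= J[y] + L^2, hence J[y] >= L^2
    ([J_lower_bound]). The explicit solution is the curve with u(x) = L x; its
    derivative is L / sqrt(m(y)), so its integrand is the constant L^2 and the
    bound is attained ([J_explicit]).

    A competitor is only differentiable, so u' need be neither continuous nor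
    integrable and the fundamental theorem of calculus cannot be quoted for u.
    What the argument needs is one inequality: if u' <= p at every point of
    [0,1], with p nonnegative and measurable, then u(1) - u(0) <= int p
    ([increment_le_integral]). As in the Vitali-Caratheodory theorem, p is
    replaced by a larger w with nearly the same integral such that around every
    x the values of w stay above some constant exceeding p(x) ([lsc_majorant]).
    Then W(z) = int_0^z w grows near every point at least as fast as u,
    so W - u is locally increasing at every point, hence
    increasing ([le_of_locally_increasing]).

    F is a strictly increasing bijection from [0,1] onto [0,L], which gives
    existence and uniqueness of the explicit solution. The implicit equation is
    equivalent to the explicit one: both say that y' is proportional to
    1 / sqrt(m(y)) with y(0) = 0 and y(1) = 1 ([implicit_explicit],
    [explicit_implicit]). The delicate point is that a solution of the implicit
    equation is not assumed to be measurable. Integrals of nonnegative functions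
    are monotone in the domain even without measurability, so such a y is
    nondecreasing, thus measurable, thus Lipschitz, thus continuous
    ([implicit_within_continuous]). *)

Local Notation mu := lebesgue_measure.

(** * Derivatives relative to the unit interval *)

(** The filter is the one of [derive01]; having the derivative as an argument
    avoids manipulating [lim]. *)
Definition has_derivative01 {R : realType} (y : R -> R) (x d : R) : Prop :=
  (y z - y x) / (z - x) @[z --> within `[0, 1] x^'] --> d.

Lemma within01P {R : realType} (x : R) (P : set R) :
  within `[0, 1] x^' P <->
  exists2 d : R, 0 < d &
    forall z, z \in `[0, 1] -> z != x -> `|z - x| < d -> P z.
Proof.
split.
  move=> /nbhs_ballP[d /= d0 h]; exists d => // z z01 zx zd.
  by apply: (h z) => //; rewrite /ball /= distrC.
move=> [d d0 h]; apply/nbhs_ballP; exists d => //= z.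
by rewrite /ball /= distrC => zd zx z01; apply: h.
Qed.

(** Limits along this filter are unique because no point of [0,1] is
    isolated in it. *)
Lemma within01_proper {R : realType} (x : R) : x \in `[0, 1] ->
  ProperFilter (within `[0, 1] x^').
Proof.
rewrite in_itv /= => /andP[x0 x1]; apply: Build_ProperFilter_ex => P.
move=> /within01P[d d0 h].
have [xh|xh] := lerP x (1 / 2).
  exists (x + Num.min (d / 2) (1 / 2)); apply: h.
  - rewrite in_itv /=; have [?|?] := lerP (d / 2) (1 / 2); apply/andP; split; lra.
  - have [?|?] := lerP (d / 2) (1 / 2); apply/eqP; lra.
  - have [?|?] := lerP (d / 2) (1 / 2); rewrite addrC addKr ger0_norm; lra.
exists (x - Num.min (d / 2) (1 / 2)); apply: h.
- rewrite in_itv /=; have [?|?] := lerP (d / 2) (1 / 2); apply/andP; split; lra.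
- have [?|?] := lerP (d / 2) (1 / 2); apply/eqP; lra.
- have [?|?] := lerP (d / 2) (1 / 2); rewrite addrC addKr normrN ger0_norm; lra.
Qed.

Lemma has_derivative01_derive01 {R : realType} (y : R -> R) (x d : R) :
  x \in `[0, 1] -> has_derivative01 y x d ->
  derivable01 y x /\ derive01 y x = d.
Proof.
move=> x01 yd; have pf := within01_proper x x01; split.
  by apply: cvgP yd.
exact: cvg_lim yd.
Qed.

Lemma derivable01_has_derivative {R : realType} (y : R -> R) (x : R) :
  derivable01 y x -> has_derivative01 y x (derive01 y x).
Proof. by []. Qed.

(** Let c be the supremum of the points of [a,b] where h is at least h a.
    Monotonicity to the left of c puts c in this set, and monotonicity
    to its right would put a point beyond c in it if c < b. No
    regularity of h is involved. *)
Lemma le_of_locally_increasing {R : realType} (h : R -> R) (a b : R) :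
  a <= b ->
  (forall x, x \in `[a, b] -> exists2 d : R, 0 < d &
     forall z, z \in `[a, b] -> `|z - x| < d ->
       (x <= z -> h x <= h z) /\ (z <= x -> h z <= h x)) ->
  h a <= h b.
Proof.
move=> ab hloc.
pose S := [set x | x \in `[a, b] /\ h a <= h x].
have Sa : S a by split; rewrite // in_itv /= lexx ab.
have Sub : has_sup S.
  by split; [exists a | exists b => x [] /=; rewrite in_itv /= => /andP[]].
set c := sup S.
have ac : a <= c by apply: ub_le_sup => //; case: Sub.
have cb : c <= b.
  by apply: ge_sup; [exists a | move=> x [] /=; rewrite in_itv /= => /andP[]].
have c_ab : c \in `[a, b] by rewrite in_itv /= ac cb.
have [d d0 hd] := hloc c c_ab.
have [x [x_ab hx] cdx] := @sup_adherent _ S d d0 Sub.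
have xc : x <= c by apply: ub_le_sup => //; case: Sub.
have hc : h a <= h c.
  apply: (le_trans hx); apply: (hd x x_ab _).2 => //.
  by move: cdx; rewrite -/c ler0_norm ?subr_le0// => ?; lra.
have [bcd|cdb] := lerP b (c + d / 2).
  apply: (le_trans hc); apply: (hd b _ _).1 => //.
    by rewrite in_itv /= lexx ab.
  by rewrite ger0_norm ?subr_ge0//; lra.
have : S (c + d / 2).
  split; first by rewrite in_itv /=; apply/andP; split; lra.
  apply: (le_trans hc); apply: (hd _ _ _).1; last by lra.
    by rewrite in_itv /=; apply/andP; split; lra.
  by rewrite addrC addKr ger0_norm; lra.
move=> /(ub_le_sup (proj2 Sub)); rewrite -/c; lra.
Qed.

Lemma has_derivative01_lt_bound {R : realType} (u : R -> R) (x d c : R) :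
  has_derivative01 u x d -> d < c ->
  exists2 e : R, 0 < e & forall z, z \in `[0, 1] -> `|z - x| < e ->
    (x <= z -> u z - u x <= c * (z - x)) /\
    (z <= x -> u x - u z <= c * (x - z)).
Proof.
move=> ud dc.
have : \forall z \near within `[0, 1] x^', (u z - u x) / (z - x) < c.
  by apply: (ud [set t | t < c]); exact: lt_nbhsl.
move=> /within01P[e e0 h]; exists e => // z z01 zxe.
have [->|zx] := eqVneq z x; first by rewrite !subrr mulr0.
have := h z z01 zx zxe => hq; split => xz.
  by rewrite -ler_pdivrMr ?ltW// subr_gt0 lt_neqAle eq_sym zx.
rewrite -ler_pdivrMr ?subr_gt0 ?lt_neqAle ?zx// ltW//.
by rewrite -[u x - _]opprB -[x - z]opprB invrN mulrNN.
Qed.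

Lemma has_derivative01_continuous {R : realType} (u : R -> R) (x d : R) :
  has_derivative01 u x d -> u z @[z --> within `[0, 1] x^'] --> u x.
Proof.
move=> ud.
have zx : (z - x) @[z --> within `[0, 1] x^'] --> (0 : R).
  apply/cvgrPdist_lt => e e0; apply/within01P; exists e => // z _ _.
  by rewrite sub0r normrN.
have h : ((u z - u x) / (z - x) * (z - x) + u x)
    @[z --> within `[0, 1] x^'] --> d * 0 + u x.
  by apply: cvgD; [exact: cvgM ud zx | exact: cvg_cst].
rewrite mulr0 add0r in h; apply: cvg_trans h; apply: near_eq_cvg.
apply/within01P; exists 1 => // z _ zx1 _ /=.
by rewrite divfK ?subr_eq0// subrK.
Qed.

Lemma has_derivative01_within_continuous {R : realType} (u d : R -> R) :
  {in `[0, 1], forall x, has_derivative01 u x (d x)} ->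
  {within `[0, 1], continuous u}.
Proof.
move=> ud; apply/subspace_continuousP => x x01.
have := has_derivative01_continuous u x (d x) (ud x x01).
move=> ux W /[dup] /nbhs_singleton Wx /ux /within01P[e e0 h].
apply/nbhs_ballP; exists e => //= z; rewrite /ball /= distrC => zx z01.
by have [->|znx] := eqVneq z x; [|exact: h].
Qed.

Lemma within_continuous_cvg {R : realType} (f : R -> R) (x : R) :
  {within `[0, 1], continuous f} -> x \in `[0, 1] ->
  f z @[z --> within `[0, 1] (nbhs x)] --> f x.
Proof. by move=> /subspace_continuousP + x01; apply. Qed.

Lemma has_derivative01B {R : realType} (u v : R -> R) (x a b : R) :
  has_derivative01 u x a -> has_derivative01 v x b ->
  has_derivative01 (u \- v) x (a - b).
Proof.
move=> ua vb; apply: cvg_trans (cvgB ua vb); apply: near_eq_cvg.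
apply: nearW => z.
rewrite [RHS](_ : _ = (u z - v z - (u x - v x)) / (z - x))//.
by rewrite !fctE -mulrBl; congr (_ / _); ring.
Qed.

Lemma has_derivative01Z {R : realType} (u : R -> R) (c x a : R) :
  has_derivative01 u x a -> has_derivative01 (fun z => c * u z) x (c * a).
Proof.
move=> ua; apply: cvg_trans (cvgM (cvg_cst c) ua); apply: near_eq_cvg.
by apply: nearW => z /=; rewrite mulrA mulrBr.
Qed.

Lemma eq_has_derivative01 {R : realType} (u v : R -> R) (x a : R) :
  {in `[0, 1], u =1 v} -> x \in `[0, 1] ->
  has_derivative01 u x a -> has_derivative01 v x a.
Proof.
move=> uv x01; apply: cvg_trans; apply: near_eq_cvg.
by apply/within01P; exists 1 => // z z01 _ _; rewrite !uv.
Qed.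

Lemma has_derivative01_id {R : realType} (x : R) : has_derivative01 id x 1.
Proof.
apply/cvgrPdist_lt => e e0; apply/within01P; exists 1 => // z _ zx _.
by rewrite divff ?subr_eq0// subrr normr0.
Qed.

(** For every e > 0 the function e x - u(x) is locally increasing; let e
    tend to 0. *)
Lemma le_of_derivative01_le0 {R : realType} (u d : R -> R) (a b : R) :
  {in `[0, 1], forall x, has_derivative01 u x (d x)} ->
  {in `[0, 1], forall x, d x <= 0} ->
  0 <= a -> a <= b -> b <= 1 -> u b <= u a.
Proof.
move=> ud d0 a0 ab b1; apply/ler_addgt0Pr => e e0.
have sub x : x \in `[a, b] -> x \in `[0, 1].
  by rewrite !in_itv /= => /andP[/(le_trans a0)-> /le_trans]; apply.
have : e * a - u a <= e * b - u b.
  apply: (le_of_locally_increasing (fun x => e * x - u x) a b ab) => x /sub x01.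
  have [t t0 ht] := has_derivative01_lt_bound u x (d x) e (ud x x01)
    (le_lt_trans (d0 x x01) e0).
  exists t => // z /sub z01 zx; have [h1 h2] := ht z z01 zx.
  by split=> [/h1|/h2]; lra.
have : e * b - e * a <= e by rewrite -mulrBr ler_piMr ?(ltW e0)//; lra.
lra.
Qed.

Lemma eq_of_derivative01 {R : realType} (u v d : R -> R) :
  {in `[0, 1], forall x, has_derivative01 u x (d x)} ->
  {in `[0, 1], forall x, has_derivative01 v x (d x)} ->
  u 0 = v 0 -> {in `[0, 1], u =1 v}.
Proof.
have le f g : {in `[0, 1], forall x, has_derivative01 f x (d x)} ->
    {in `[0, 1], forall x, has_derivative01 g x (d x)} ->
    f 0 = g 0 -> {in `[0, 1], forall x, f x <= g x}.
  move=> fd gd fg0 x; rewrite in_itv /= => /andP[x0 x1].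
  rewrite -subr_le0 -(subrr (g 0)) -{1}fg0.
  apply: (le_of_derivative01_le0 (f \- g) (fun t => d t - d t) 0 x) => //.
    by move=> t t01; apply: has_derivative01B; [exact: fd | exact: gd].
  by move=> t _; rewrite subrr.
move=> ud vd uv0 x x01; apply/le_anti.
by rewrite (le u v)// (le v u).
Qed.

(** * Increments of everywhere differentiable functions *)

(** One half of the Vitali-Caratheodory theorem. Cut D into the level sets
    A k of p of height eta and enclose each in an open set U k so close to it
    that the weighted excesses sum to at most e / 2; then w, the sum of the
    indicators of the U k weighted by the upper levels, has the required
    properties: its integral exceeds that of p by at most eta mu(D) + e / 2, and
    it is at least the upper level c k on the whole neighbourhood U k of
    any x in A k. *)
Lemma lsc_majorant {R : realType} (D : set R) (p : R -> R) (e : R) :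
  measurable D -> (mu D < +oo)%E -> measurable_fun D p ->
  (forall x, D x -> 0 <= p x) -> 0 < e ->
  exists w : R -> \bar R,
    [/\ measurable_fun setT w, forall x, (0 <= w x)%E,
        (\int[mu]_(x in D) w x <= \int[mu]_(x in D) (p x)%:E + e%:E)%E &
        forall x, D x -> exists2 c, p x < c &
          exists2 r : R, 0 < r & forall z, `|z - x| < r -> (c%:E <= w z)%E].
Proof.
move=> mD Doo mp p0 e0.
have M0 : 0 <= fine (mu D) by rewrite fine_ge0.
(* Rounding p up to the next level costs at most eta * mu D < e / 2; the + 1
   keeps the denominator positive when D is negligible. *)
pose eta := e / 2 / (fine (mu D) + 1).
have eta0 : 0 < eta by rewrite !divr_gt0// ltr_wpDl.
pose c (k : nat) := k.+1%:R * eta.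
have c0 k : 0 < c k by rewrite mulr_gt0.
pose A (k : nat) := D `&` p @^-1` `[k%:R * eta, c k[%classic.
have mA k : measurable (A k) by apply: mp => //; exact: measurable_itv.
have AD k : A k `<=` D by move=> x [].
have tA : trivIset setT A.
  apply/trivIsetP => i j _ _ ij; apply/seteqP; split => // x [[_ /=]] + [_ /=].
  rewrite !in_itv /= => /andP[ix xi] /andP[jx xj].
  have := le_lt_trans ix xj; have := le_lt_trans jx xi.
  rewrite !ltr_pM2r// !ltr_nat !ltnS => ji ij'.
  by move: ij; rewrite eqn_leq ij' ji.
have UA : \bigcup_k A k = D.
  apply/seteqP; split => [x [k _] /AD//|x Dx].
  exists (Num.trunc (p x / eta)) => //; split => //=.
  have := Num.Theory.truncn_itv (divr_ge0 (p0 x Dx) (ltW eta0)).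
  by rewrite in_itv /= ler_pdivlMr// ltr_pdivrMr// => /andP[-> ->].
(* The open set U k may exceed A k by measure de k / c k: weighted by c k, these
   excesses sum to e / 2. *)
pose de (k : nat) := e / 2 / (2 ^ k.+1)%:R.
have de0 k : 0 < de k by rewrite !divr_gt0.
have /choice[U HU] : forall k, exists V,
    [/\ open V, A k `<=` V & (mu (V `\` A k) < (de k / c k)%:E)%E].
  move=> k.
  apply: lebesgue_regularity_outer => //; last by rewrite divr_gt0.
  apply: le_lt_trans Doo.
  by apply: le_measure; rewrite ?inE; [exact: mA|exact: mD|exact: AD].
have mU k : measurable (U k) by apply: open_measurable; case: (HU k).
pose f k (x : R) := ((c k)%:E * (\1_(U k) x)%:E)%E.
have f0 k x : (0 <= f k x)%E by rewrite mule_ge0// lee_fin// ltW.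
have mf k : measurable_fun setT (f k).
  by apply: emeasurable_funM => //; exact/measurable_EFinP.
have mfS k (B : set R) : measurable_fun B (f k) by exact: measurable_funTS (mf k).
exists (fun x => \sum_(k <oo) f k x)%E; split.
- by apply: ge0_emeasurable_sum => //.
- by move=> x; exact: nneseries_ge0.
- rewrite integral_nneseries//; last by move=> n; exact: mfS.
  have termle k : (\int[mu]_(x in D) f k x <=
      \int[mu]_(x in A k) (p x + eta)%:E + (de k)%:E)%E.
    have [_ AU muUA] := HU k.
    have mI : measurable_fun D (\1_(U k) : R -> R).
      apply: measurable_indic; exact: mU.
    have mI' : measurable_fun D (fun x => (\1_(U k) x)%:E : \bar R).
      exact/measurable_EFinP.
    rewrite (@ge0_integralZl_EFin _ _ _ mu D mD _ _ mI')//; last exact: ltW.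
    rewrite integral_indic; [|exact: mD|exact: mU].
    have mUD : (mu (U k `&` D) <= mu (U k `\` A k) + mu (A k))%E.
      apply: (@le_trans _ _ (mu (U k))).
        apply: le_measure; rewrite ?inE; last by move=> x [].
          by apply: measurableI; [exact: mU|exact: mD].
        exact: mU.
      rewrite (measureDI mu (mU k) (mA k)) (setIidr AU).
      exact: lexx.
    apply: (@le_trans _ _ ((c k)%:E * ((de k / c k)%:E + mu (A k)))%E).
      apply: lee_pmul => //; first by rewrite lee_fin ltW.
      by apply: (le_trans mUD); apply: leeD2r => //; exact: ltW.
    rewrite ge0_muleDr//; last by rewrite lee_fin ltW// divr_gt0.
    rewrite -EFinM mulrCA divff ?mulr1 ?gt_eqF// [leRHS]addeC.
    apply: leeD2l; rewrite -integral_cst; last exact: mA.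
    apply: ge0_le_integral; [exact: mA | | | |].
    + by move=> x _; rewrite lee_fin ltW.
    + exact: measurable_cst.
    + apply/measurable_EFinP; apply: measurable_funD => //.
      exact: measurable_funS mp.
    + move=> x [_ /=]; rewrite in_itv /= => /andP[kp _].
      by rewrite lee_fin /c -natr1 mulrDl mul1r lerD2r.
  apply: (le_trans (lee_nneseries _ (fun k _ => termle k))).
    by move=> k _ _; exact: integral_ge0.
  have pe0 x : D x -> (0 <= (p x + eta)%:E)%E.
    by move=> Dx; rewrite lee_fin addr_ge0 ?p0// ltW.
  have mpe : measurable_fun D (fun x => (p x + eta)%:E).
    by apply/measurable_EFinP; exact: measurable_funD.
  rewrite nneseriesD; last 2 first.
  + by move=> k _ _; apply: integral_ge0 => x /AD; exact: pe0.
  + by move=> k _ _; rewrite lee_fin ltW.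
  rewrite -ge0_integral_bigcup ?UA//.
  under eq_integral do rewrite EFinD.
  rewrite ge0_integralD//; last 2 first.
  + exact/measurable_EFinP.
  + by move=> x _; rewrite lee_fin ltW.
  rewrite integral_cst// -addeA; apply: leeD2l.
  apply: (@le_trans _ _ ((e / 2)%:E + (e / 2)%:E)%E); last first.
    by rewrite -EFinD lee_fin; lra.
  apply: leeD; last by apply: epsilon_trick0; rewrite divr_ge0// ltW.
  have muDE : mu D = (fine (mu D))%:E by rewrite fineK// ge0_fin_numE.
  apply: (@le_trans _ _ (eta%:E * mu D)%E); first exact: lexx.
  rewrite muDE.
  rewrite -EFinM lee_fin /eta mulrAC ler_pdivrMr ?ltr_wpDl//.
  by rewrite ler_wpM2l ?lerDl ?divr_ge0 ?(ltW e0).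
- move=> x Dx.
  have [k _ Akx] : (\bigcup_k A k) x by rewrite UA.
  exists (c k); first by case: Akx => _ /=; rewrite in_itv /= => /andP[].
  have [oU AU _] := HU k.
  have : nbhs x (U k) by apply: open_nbhs_nbhs; split => //; exact: AU.
  move=> /nbhs_ballP[r /= r0 rU]; exists r => // z zr.
  have Uz : U k z by apply: rU; rewrite /ball /= distrC.
  have -> : (c k)%:E = f k z by rewrite /f indicE mem_set// mule1.
  apply: (@le_trans _ _ (\sum_(0 <= i < k.+1) f i z)%E).
    by rewrite big_nat_recr//= leeDr// sume_ge0.
  exact: nneseries_lim_ge.
Qed.

(** Stated for extended-real w because the majorant of [lsc_majorant] may be
    infinite at some points. *)
Lemma integral_growth {R : realType} (w : R -> \bar R) (x z c : R) :
  measurable_fun setT w -> (forall t, 0 <= w t)%E ->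
  (\int[mu]_(t in `[0%R, 1%R]) w t < +oo)%E ->
  0 <= x -> x <= z -> z <= 1 ->
  0 <= c -> (forall t, x <= t -> t <= z -> (c%:E <= w t)%E) ->
  c * (z - x) <= fine (\int[mu]_(t in `[0%R, z]) w t) -
    fine (\int[mu]_(t in `[0%R, x]) w t).
Proof.
move=> mw w0 woo x0 xz z1 c0 cw.
have mwS A : measurable_fun A w by apply: measurable_funTS.
have fin y : y <= 1 -> (\int[mu]_(t in `[0%R, y]) w t)%E \is a fin_num.
  move=> y1; rewrite ge0_fin_numE; last exact: integral_ge0.
  apply: le_lt_trans woo; apply: ge0_subset_integral => //; first exact: mwS.
  by apply: subset_itvl; rewrite bnd_simp.
have E : (\int[mu]_(t in `[0%R, z]) w t = \int[mu]_(t in `[0%R, x]) w t +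
    \int[mu]_(t in `]x, z]) w t)%E.
  rewrite (@itv_bndbnd_setU _ _ _ (BRight x)) ?bnd_simp//.
  rewrite ge0_integral_setU//; first exact: mwS.
  apply/disj_setPS => t [/=]; rewrite !in_itv /= => /andP[_ tx] /andP[xt _].
  by move: tx; rewrite leNgt xt.
have low : ((c * (z - x))%:E <= \int[mu]_(t in `]x, z]) w t)%E.
  have -> : ((c * (z - x))%:E = \int[mu]_(t in `]x, z]) (cst c%:E) t)%E.
    rewrite integral_cst//= lebesgue_measure_itv /= lte_fin.
    case: ltP => xz'; first by rewrite -EFinB -EFinM.
    have -> : z = x by apply/le_anti; rewrite xz xz'.
    by rewrite subrr mulr0 mule0.
  apply: ge0_le_integral => //; first exact: mwS.
  move=> t /=; rewrite in_itv /= => /andP[xt tz]; exact: cw (ltW xt) tz.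
have Fz := fin z z1; have Fx := fin x (le_trans xz z1).
rewrite -lee_fin (le_trans low)// EFinB !fineK// E addeAC subee// add0e//.
Qed.

(** Replaces the fundamental theorem of calculus when u' exists everywhere but
    may fail to be integrable: the primitive of a majorant w of p grows near
    every point at least as fast as u. *)
Lemma increment_le_integral {R : realType} (u d p : R -> R) :
  {in `[0, 1], forall x, has_derivative01 u x (d x)} ->
  {in `[0, 1], forall x, d x <= p x} ->
  {in `[0, 1], forall x, 0 <= p x} ->
  measurable_fun (`[0, 1] : set R) p ->
  ((u 1 - u 0)%:E <= \int[mu]_(x in `[0%R, 1%R]) (p x)%:E)%E.
Proof.
move=> ud dp p0 mp.
have [->|] := eqVneq (\int[mu]_(x in `[0%R, 1%R]) (p x)%:E)%E (+oo)%E.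
  by rewrite leey.
rewrite -ltey => poo.
apply/lee_addgt0Pr => e e0.
have mu01 : (mu (`[0%R, 1%R] : set R) < +oo)%E.
  by rewrite lebesgue_measure_itv /= lte01 sube0 ltry.
have [w [mw w0 wp wloc]] := lsc_majorant `[0, 1] p e (measurable_itv _) mu01
  mp p0 e0.
have woo : (\int[mu]_(x in `[0%R, 1%R]) w x < +oo)%E.
  by apply: le_lt_trans wp _; rewrite lte_add_pinfty// ltry.
apply: le_trans wp.
pose W z := fine (\int[mu]_(t in `[0%R, z]) w t)%E.
have W0 : W 0 = 0 by rewrite /W set_itv1 integral_set1.
have W1 : (W 1)%:E = (\int[mu]_(t in `[0%R, 1%R]) w t)%E.
  by rewrite /W fineK// ge0_fin_numE//; exact: integral_ge0.
rewrite -W1 lee_fin.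
suff : W 0 - u 0 <= W 1 - u 1 by rewrite W0; lra.
apply: (le_of_locally_increasing (fun z => W z - u z)) => // x x01.
have [c pc [r r0 cw]] := wloc x x01.
have [r' r'0 hu] := has_derivative01_lt_bound u x (d x) c (ud x x01)
  (le_lt_trans (dp x x01) pc).
have c0 : 0 <= c by apply: (le_trans (p0 x x01)); exact: ltW.
exists (Num.min r r'); first by rewrite lt_min r0.
move=> z z01; rewrite lt_min => /andP[zr zr'].
have [h1 h2] := hu z z01 zr'.
move: (x01) (z01); rewrite !in_itv /= => /andP[x0 x1] /andP[z0 z1].
split=> xz.
  have := integral_growth w x z c mw w0 woo x0 xz z1 c0.
  rewrite -/(W z) -/(W x) => H; have {}H := H _.
  have := h1 xz; suff : c * (z - x) <= W z - W x by lra.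
  apply: H => t xt tz; apply: cw; move: zr; rewrite !ger0_norm ?subr_ge0//.
  by apply: le_lt_trans; rewrite lerD2r.
have := integral_growth w z x c mw w0 woo z0 xz x1 c0.
rewrite -/(W z) -/(W x) => H.
have := h2 xz; suff : c * (x - z) <= W x - W z by lra.
apply: H => t zt tx; apply: cw; move: zr; rewrite !ler0_norm ?subr_le0//.
by apply: le_lt_trans; rewrite lerN2 lerD2r.
Qed.

(** * Primitives, chain rule and measurability of the derivative *)

Lemma Rintegral_increment_bounds {R : realType} (f : R -> R) (x z lo hi : R) :
  mu.-integrable (`[0, 1] : set R) (EFin \o f) ->
  0 <= x -> x <= z -> z <= 1 ->
  (forall t, x <= t -> t <= z -> lo <= f t <= hi) ->
  lo * (z - x) <= \int[mu]_(s in `[0, z]) f s - \int[mu]_(s in `[0, x]) f s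
    <= hi * (z - x).
Proof.
move=> intf x0 xz z1 bf.
have intS (A : set R) : measurable A -> A `<=` `[0, 1] ->
    mu.-integrable A (EFin \o f).
  by move=> mA A01; apply: integrableS intf.
have sub : [set` `]x, z]] `<=` `[(0 : R), 1].
  by apply: subset_itv; rewrite bnd_simp.
rewrite Rintegral_itvB ?bnd_simp//; last first.
  by apply: intS => //; apply: subset_itvl; rewrite bnd_simp.
have cst_int c : mu.-integrable (`]x, z] : set R) (EFin \o cst c).
  apply: integrableS (_ : mu.-integrable (`[x, z] : set R) _) => //.
    by apply: subset_itvr; rewrite bnd_simp.
  apply: continuous_compact_integrable; first exact: segment_compact.
  by apply: continuous_subspaceT => ?; exact: cvg_cst.
have E c : c * (z - x) = \int[mu]_(s in `]x, z]) c.
  rewrite Rintegral_cst//= lebesgue_measure_itv /= lte_fin.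
  case: ltP => // zx.
  have -> : z = x by apply/le_anti; rewrite xz zx.
  by rewrite subrr !mulr0.
have inI t : [set` `]x, z]] t -> lo <= f t <= hi.
  by rewrite /= in_itv /= => /andP[xt tz]; apply: bf => //; exact: ltW.
rewrite !E; apply/andP; split; apply: le_Rintegral => //.
- exact: cst_int.
- exact: intS.
- by move=> t /inI/andP[].
- exact: intS.
- exact: cst_int.
- by move=> t /inI/andP[].
Qed.

Lemma has_derivative01_Rintegral {R : realType} (f : R -> R) (x : R) :
  {within `[0, 1], continuous f} -> x \in `[0, 1] ->
  has_derivative01 (fun x => \int[mu]_(s in `[0, x]) f s) x (f x).
Proof.
move=> fc x01.
have intf : mu.-integrable (`[0, 1] : set R) (EFin \o f).
  by apply: continuous_compact_integrable => //; exact: segment_compact.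
apply/cvgrPdist_le => e e0.
have /cvgrPdist_le/(_ e e0)/nbhs_ballP[d /= d0 hd] :=
  within_continuous_cvg f x fc x01.
apply/within01P; exists d => // z z01 zx zxd.
have fb t : t \in `[0, 1] -> `|t - x| < d -> f x - e <= f t <= f x + e.
  move=> t01 txd; have := hd t.
  by rewrite /ball /= distrC => /(_ txd t01); rewrite distrC ler_distl.
move: (x01) (z01); rewrite !in_itv /= => /andP[x0 x1] /andP[z0 z1].
rewrite distrC ler_distl.
have [xz|zx'] := ltP x z.
  rewrite ler_pdivlMr ?subr_gt0// ler_pdivrMr ?subr_gt0//.
  apply: Rintegral_increment_bounds => //; first exact: ltW.
  move=> t xt tz; apply: fb; first by rewrite in_itv /=; apply/andP; split; lra.
  move: zxd; rewrite !ger0_norm ?subr_ge0//; last exact: ltW.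
  by apply: le_lt_trans; rewrite lerD2r.
have {zx'} zx' : z < x by rewrite lt_neqAle zx.
rewrite -[X in X / _]opprB -[z - x]opprB invrN mulrNN.
rewrite ler_pdivlMr ?subr_gt0// ler_pdivrMr ?subr_gt0//.
apply: Rintegral_increment_bounds => //; first exact: ltW.
move=> t zt tx; apply: fb; first by rewrite in_itv /=; apply/andP; split; lra.
move: zxd; rewrite !ler0_norm ?subr_le0//; last exact: ltW.
by apply: le_lt_trans; rewrite lerN2 lerD2r.
Qed.

(** The difference quotient of G at c, completed by the value a on the
    diagonal. With a the derivative of G at c it is continuous at c, so that
    composing it with y needs no assumption that y z differs from y x. *)
Definition slope {R : realType} (G : R -> R) (c a b : R) : R :=
  if b == c then a else (G b - G c) / (b - c).

Lemma slopeE {R : realType} (G : R -> R) (c a b : R) :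
  G b - G c = slope G c a b * (b - c).
Proof.
rewrite /slope; case: eqVneq => [->|bc]; first by rewrite !subrr mulr0.
by rewrite divfK ?subr_eq0.
Qed.

Lemma cvg_slope {R : realType} (G y : R -> R) (x a : R) :
  maps01 y -> has_derivative01 G (y x) a ->
  y z @[z --> within `[0, 1] x^'] --> y x ->
  slope G (y x) a (y z) @[z --> within `[0, 1] x^'] --> a.
Proof.
move=> y01 Ga yc; apply/cvgrPdist_le => e e0.
have /cvgrPdist_le/(_ e e0)/within01P[d d0 hd] := Ga.
have /cvgrPdist_lt/(_ d d0)/within01P[r r0 hr] := yc.
apply/within01P; exists r => // z z01 zx zxr.
rewrite /slope; case: eqVneq => [_|yzx]; first by rewrite subrr normr0 ltW.
by apply: hd => //; [exact: y01 | rewrite distrC; exact: hr].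
Qed.

Lemma has_derivative01_comp {R : realType} (G y : R -> R) (x a b : R) :
  maps01 y -> has_derivative01 G (y x) a -> has_derivative01 y x b ->
  has_derivative01 (G \o y) x (a * b).
Proof.
move=> y01 Ga yb.
have yc := has_derivative01_continuous y x b yb.
apply: cvg_trans (cvgM (cvg_slope G y x a y01 Ga yc) yb).
apply: near_eq_cvg; apply: nearW => z.
by rewrite !fctE /= (slopeE G (y x) a) mulrA.
Qed.

(** On [0,1) the derivative is the limit of the forward quotients with
    step 1/(n+1), truncated at 1 so that y is evaluated only inside [0,1]; a
    truncated quotient is not a true one, but for fixed x < 1 only finitely many
    are truncated. *)
Lemma measurable_derive01 {R : realType} (y : R -> R) :
  {in `[0, 1], forall x, derivable01 y x} ->
  measurable_fun (`[0, 1] : set R) (derive01 y).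
Proof.
move=> yd.
have yc : {within `[0, 1], continuous y}.
  apply: (has_derivative01_within_continuous y (derive01 y)) => x x01.
  by apply: derivable01_has_derivative; exact: yd.
have my : measurable_fun (`[0, 1] : set R) y.
  exact: subspace_continuous_measurable_fun.
have quot_cvg (x : R) : 0 <= x -> x < 1 ->
    (y (Num.min (x + n.+1%:R^-1) 1) - y x) / n.+1%:R^-1 @[n --> \oo]
      --> derive01 y x.
  move=> x0 x1.
  have x01 : x \in `[0, 1] by rewrite in_itv /= x0 ltW.
  have := derivable01_has_derivative y x (yd x x01).
  move=> yx; apply/cvgrPdist_le => e e0.
  have /cvgrPdist_le/(_ e e0)/within01P[d d0 hd] := yx.
  have dx0 : 0 < Num.min d (1 - x) by rewrite lt_min d0 subr_gt0.
  have /cvgrPdist_lt/(_ _ dx0) := @cvg_harmonic R.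
  apply: filterS => n.
  have n0 : 0 < n.+1%:R^-1 :> R by rewrite invr_gt0.
  rewrite /harmonic /= sub0r normrN gtr0_norm// lt_min => /andP[nd nx].
  have -> : Num.min (x + n.+1%:R^-1) 1 = x + n.+1%:R^-1.
    by apply/min_idPl; rewrite -lerBrDl ltW.
  have {2}-> : n.+1%:R^-1 = (x + n.+1%:R^-1) - x by rewrite addrC addKr.
  apply: hd.
  - by rewrite in_itv /= addr_ge0 ?(ltW n0)// -lerBrDl (ltW nx).
  - by rewrite gt_eqF// ltrDl.
  - by rewrite addrC addKr gtr0_norm.
have -> : [set` `[(0 : R), 1]] = `[0, 1[%classic `|` [set 1].
  by rewrite setUitv1// bnd_simp.
apply/measurable_funU => //; split; last exact: measurable_fun_set1.
apply: (@measurable_fun_cvg _ _ _ _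
  (fun n (x : R) => (y (Num.min (x + n.+1%:R^-1) 1) - y x) / n.+1%:R^-1)).
  move=> n; apply: measurable_funM; last exact: measurable_cst.
  apply: measurable_funB; last first.
    by apply: measurable_funS my => //; apply: subset_itvl; rewrite bnd_simp.
  apply: (@measurable_comp _ _ _ _ _ _ (`[0, 1] : set R) y _
    (fun x : R => Num.min (x + n.+1%:R^-1) 1)) => //.
    move=> _ [x /= + <-]; rewrite !in_itv /= => /andP[x0 x1].
    rewrite ge_min lexx orbT andbT le_min ler01 andbT.
    by rewrite addr_ge0// invr_ge0.
  by apply: measurable_minr; [exact: measurable_funD|exact: measurable_cst].
by move=> x; rewrite /= in_itv /= => /andP[]; exact: quot_cvg.
Qed.

Lemma within_continuous_comp01 {R : realType} (f y : R -> R) :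
  maps01 y -> {within `[0, 1], continuous y} ->
  {within `[0, 1], continuous f} -> {within `[0, 1], continuous (f \o y)}.
Proof.
move=> y01 yc fc; apply/subspace_continuousP => x x01.
have /cvgrPdist_lt fx := within_continuous_cvg f (y x) fc (y01 x x01).
have /cvgrPdist_lt yx := within_continuous_cvg y x yc x01.
apply/cvgrPdist_lt => e e0.
have /nbhs_ballP[d d0 hd] := fx e e0.
have /nbhs_ballP[r r0 hr] := yx d d0.
apply/nbhs_ballP; exists r => // z zr z01.
by apply: hd; [exact: hr | exact: y01].
Qed.

Lemma within_continuous_sqrt {R : realType} (f : R -> R) :
  {within `[0, 1], continuous f} ->
  {within `[0, 1], continuous (fun x => Num.sqrt (f x))}.
Proof.
move=> fc; apply/subspace_continuousP => x x01.
apply: (cvg_comp f Num.sqrt); first exact: within_continuous_cvg.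
exact: sqrt_continuous.
Qed.

Lemma within_continuous_inv {R : realType} (f : R -> R) :
  {in `[0, 1], forall x, 0 < f x} -> {within `[0, 1], continuous f} ->
  {within `[0, 1], continuous (fun x => (f x)^-1)}.
Proof.
move=> f0 fc; apply/subspace_continuousP => x x01.
apply: cvgV; first by rewrite gt_eqF// f0.
exact: within_continuous_cvg.
Qed.

(** * The explicit solution *)

Lemma F0 {R : realType} (m : R -> R) : F m 0 = 0.
Proof. by rewrite /F set_itv1 Rintegral_set1. Qed.

Lemma has_derivative01_F {R : realType} (m : R -> R) :
  {within `[0, 1], continuous m} ->
  {in `[0, 1], forall x, has_derivative01 (F m) x (Num.sqrt (m x))}.
Proof.
move=> mc x x01; apply: has_derivative01_Rintegral => //.
exact: within_continuous_sqrt.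
Qed.

(** Quantitative strict monotonicity; it gives both the injectivity of F and the
    Lipschitz bound for its inverse. *)
Lemma F_growth {R : realType} (m : R -> R) (m1 a b : R) :
  {within `[0, 1], continuous m} -> {in `[0, 1], forall s, m1 <= m s} ->
  0 <= a -> a <= b -> b <= 1 ->
  Num.sqrt m1 * (b - a) <= F m b - F m a.
Proof.
move=> mc m1m a0 ab b1.
have : Num.sqrt m1 * b - F m b <= Num.sqrt m1 * a - F m a.
  apply: (le_of_derivative01_le0 ((fun x => Num.sqrt m1 * x) \- F m)
    (fun x => Num.sqrt m1 * 1 - Num.sqrt (m x)) a b) => // x x01.
    apply: has_derivative01B; last exact: has_derivative01_F.
    by apply: has_derivative01Z; exact: has_derivative01_id.
  by rewrite mulr1 subr_le0 ler_wsqrtr// m1m.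
lra.
Qed.

Lemma F_inj {R : realType} (m : R -> R) (m1 : R) : 0 < m1 ->
  {within `[0, 1], continuous m} -> {in `[0, 1], forall s, m1 <= m s} ->
  {in `[0, 1] &, injective (F m)}.
Proof.
move=> m10 mc m1m.
have lt a b : 0 <= a -> a < b -> b <= 1 -> F m a < F m b.
  move=> a0 ab b1; rewrite -subr_gt0.
  apply: lt_le_trans (F_growth m m1 a b mc m1m a0 (ltW ab) b1).
  by rewrite mulr_gt0 ?sqrtr_gt0// subr_gt0.
move=> a b; rewrite !in_itv /= => /andP[a0 a1] /andP[b0 b1] ab.
have [ab'|ab'|//] := ltgtP a b.
  by have := lt a b a0 ab' b1; rewrite ab ltxx.
by have := lt b a b0 ab' a1; rewrite ab ltxx.
Qed.

Lemma F1_gt0 {R : realType} (m : R -> R) (m1 : R) : 0 < m1 ->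
  {within `[0, 1], continuous m} -> {in `[0, 1], forall s, m1 <= m s} ->
  0 < F m 1.
Proof.
move=> m10 mc m1m.
have := F_growth m m1 0 1 mc m1m (lexx _) ler01 (lexx _).
by rewrite F0 !subr0 mulr1; apply: lt_le_trans; rewrite sqrtr_gt0.
Qed.

Lemma exists_unique_explicit {R : realType} (m : R -> R) (m1 : R) : 0 < m1 ->
  {within `[0, 1], continuous m} -> {in `[0, 1], forall s, m1 <= m s} ->
  exists_unique01 (explicit_solution m).
Proof.
move=> m10 mc m1m.
have L0 := F1_gt0 m m1 m10 mc m1m.
have Fc : {within `[0, 1], continuous (F m)}.
  exact: has_derivative01_within_continuous (has_derivative01_F m mc).
have /choice[y Hy] : forall x, exists c, x \in `[0, 1] ->
    c \in `[0, 1] /\ F m c = F m 1 * x.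
  move=> x; have [x01|] := boolP (x \in `[0, 1]); last by exists 0.
  have [|c c01 cE] := @IVT R (F m) 0 1 (F m 1 * x) ler01 Fc.
    move: x01; rewrite in_itv /= F0 => /andP[x0 x1].
    rewrite min_l ?(ltW L0)// max_r ?(ltW L0)// mulr_ge0 ?(ltW L0)//=.
    by rewrite ler_piMr// ltW.
  by exists c.
exists y; split; first by split=> x /Hy[].
move=> z [z01 zE] x x01; have [y01 yE] := Hy x x01.
by apply: (F_inj m m1 m10 mc m1m) => //; [exact: z01 | rewrite zE// yE].
Qed.

(** The inverse function theorem by hand: F(y(z)) - F(y(x)) = L (z - x), so
    the difference quotient of y is L divided by the slope of F between
    y(x) and y(z), which tends to sqrt(m(y(x))) once y is known to be
    continuous. *)
Lemma has_derivative01_explicit {R : realType} (m : R -> R) (m1 : R)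
    (y : R -> R) : 0 < m1 ->
  {within `[0, 1], continuous m} -> {in `[0, 1], forall s, m1 <= m s} ->
  explicit_solution m y ->
  {in `[0, 1], forall x, has_derivative01 y x (F m 1 / Num.sqrt (m (y x)))}.
Proof.
move=> m10 mc m1m [y01 yE] x x01.
have L0 := F1_gt0 m m1 m10 mc m1m.
have s0 : 0 < Num.sqrt m1 by rewrite sqrtr_gt0.
have ylip z : z \in `[0, 1] -> `|y z - y x| <= F m 1 / Num.sqrt m1 * `|z - x|.
  move=> z01; rewrite mulrAC ler_pdivlMr// mulrC.
  have -> : F m 1 * `|z - x| = `|F m (y z) - F m (y x)|.
    by rewrite !yE// -mulrBr normrM (gtr0_norm L0).
  move: (y01 z z01) (y01 x x01); rewrite !in_itv /=.
  move=> /andP[z0 z1] /andP[x0 x1].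
  have [yxz|/ltW yzx] := lerP (y x) (y z).
    by apply: le_trans (ler_norm _); exact: F_growth.
  by rewrite distrC; apply: le_trans (ler_norm _); exact: F_growth.
have yc : y z @[z --> within `[0, 1] x^'] --> y x.
  apply/cvgrPdist_lt => e e0; apply/within01P.
  exists (e / (F m 1 / Num.sqrt m1)); first by rewrite !divr_gt0.
  move=> z z01 _ zx; rewrite distrC; apply: (le_lt_trans (ylip z z01)).
  by rewrite mulrC -ltr_pdivlMr// divr_gt0.
have sx0 : 0 < Num.sqrt (m (y x)).
  by rewrite sqrtr_gt0; apply: lt_le_trans (m1m _ (y01 x x01)).
have := cvg_slope (F m) y x _ y01 (has_derivative01_F m mc _ (y01 x x01)) yc.
move=> /(cvgV (lt0r_neq0 sx0)) /(cvgM (cvg_cst (F m 1))).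
apply: cvg_trans; apply: near_eq_cvg; apply/within01P; exists 1 => // z z01 zx _.
have zx0 : z - x != 0 by rewrite subr_eq0.
have := slopeE (F m) (y x) (Num.sqrt (m (y x))) (y z).
rewrite !yE// -mulrBr => E.
have sl0 : slope (F m) (y x) (Num.sqrt (m (y x))) (y z) != 0.
  apply/eqP => sl; move: E; rewrite sl mul0r => /eqP.
  by rewrite mulf_eq0 (negbTE zx0) gt_eqF.
rewrite [LHS](_ : _ = F m 1 / slope (F m) (y x) (Num.sqrt (m (y x))) (y z))//.
by apply/eqP; rewrite eqr_div// E mulrC.
Qed.

Lemma explicit_boundary {R : realType} (m : R -> R) (m1 : R)
    (y : R -> R) : 0 < m1 ->
  {within `[0, 1], continuous m} -> {in `[0, 1], forall s, m1 <= m s} ->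
  explicit_solution m y -> y 0 = 0 /\ y 1 = 1.
Proof.
move=> m10 mc m1m [y01 yE].
have i0 : (0 : R) \in `[0, 1] by rewrite in_itv /= lexx ler01.
have i1 : (1 : R) \in `[0, 1] by rewrite in_itv /= lexx ler01.
split; apply: (F_inj m m1 m10 mc m1m) => //; rewrite ?y01// yE//.
  by rewrite mulr0 F0.
by rewrite mulr1.
Qed.

(** * The value of the functional *)

Lemma within01_measurable {R : realType} (f : R -> R) :
  {within `[0, 1], continuous f} -> measurable_fun (`[0, 1] : set R) f.
Proof. by move=> fc; exact: subspace_continuous_measurable_fun. Qed.

Lemma lebesgue_measure01 {R : realType} : mu (`[0%R, 1%R] : set R) = 1%E.
Proof. by rewrite lebesgue_measure_itv /= lte01 sube0. Qed.

Lemma integral_cst01 {R : realType} (c : \bar R) :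
  (\int[mu]_(x in `[0%R, 1%R]) cst c x)%E = c.
Proof.
rewrite integral_cst//=.
by apply: (etrans (congr1 _ lebesgue_measure01)); rewrite mule1.
Qed.

Lemma J_explicit {R : realType} (m : R -> R) (m1 : R)
    (y : R -> R) : 0 < m1 ->
  {within `[0, 1], continuous m} -> {in `[0, 1], forall s, m1 <= m s} ->
  explicit_solution m y -> J m y = (F m 1 ^+ 2)%:E.
Proof.
move=> m10 mc m1m ey; have [y01 yE] := ey.
rewrite /J (eq_integral (cst (F m 1 ^+ 2)%:E)); first exact: integral_cst01.
move=> x; rewrite inE => x01 /=; congr EFin.
have [_ ->] := has_derivative01_derive01 y x _ x01
  (has_derivative01_explicit m m1 y m10 mc m1m ey x x01).
have my0 : 0 < m (y x) by apply: lt_le_trans (m1m _ (y01 x x01)).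
by rewrite expr_div_n sqr_sqrtr ?ltW// mulrC divfK// gt_eqF.
Qed.

(** The bound 2 L u' <= m(y) y'^2 + L^2, with u = F(y), plays the role of the
    Cauchy-Schwarz inequality: it is pointwise, so no integrability of u' is
    involved, and it has the form required by [increment_le_integral]. *)
Lemma J_lower_bound {R : realType} (m : R -> R) (y : R -> R) :
  {within `[0, 1], continuous m} -> {in `[0, 1], forall s, 0 <= m s} ->
  competitor y -> ((F m 1 ^+ 2)%:E <= J m y)%E.
Proof.
move=> mc m0 [y01 yd y0 y1]; set L := F m 1.
pose p x := m (y x) * derive01 y x ^+ 2.
have p0 x : x \in `[0, 1] -> 0 <= p x.
  by move=> x01; rewrite mulr_ge0 ?sqr_ge0// m0// y01.
have yc : {within `[0, 1], continuous y}.
  apply: (has_derivative01_within_continuous y (derive01 y)) => x x01.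
  by apply: derivable01_has_derivative; exact: yd.
have mp : measurable_fun (`[0, 1] : set R) p.
  apply: measurable_funM.
    by apply: within01_measurable; exact: within_continuous_comp01.
  by apply: measurable_funX; exact: measurable_derive01.
have ud x : x \in `[0, 1] -> has_derivative01 (fun x => 2 * L * F m (y x)) x
    (2 * L * (Num.sqrt (m (y x)) * derive01 y x)).
  move=> x01; apply: has_derivative01Z; apply: has_derivative01_comp => //.
    by apply: has_derivative01_F; [exact: mc | exact: y01].
  by apply: derivable01_has_derivative; exact: yd.
have dp x : x \in `[0, 1] ->
    2 * L * (Num.sqrt (m (y x)) * derive01 y x) <= p x + L ^+ 2.
  move=> x01; rewrite /p -{2}(sqr_sqrtr (m0 _ (y01 x x01))) -subr_ge0.
  rewrite [leRHS](_ : _ = (Num.sqrt (m (y x)) * derive01 y x - L) ^+ 2).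
    exact: sqr_ge0.
  by ring.
have pL0 x : x \in `[0, 1] -> 0 <= p x + L ^+ 2.
  by move=> x01; rewrite addr_ge0 ?sqr_ge0 ?p0.
have mpL : measurable_fun (`[0, 1] : set R) (fun x => p x + L ^+ 2).
  by apply: measurable_funD => //; exact: measurable_cst.
have := increment_le_integral _ _ _ ud dp pL0 mpL.
rewrite y0 y1 F0 mulr0 subr0 -/L.
under eq_integral do rewrite EFinD.
rewrite ge0_integralD//; last 2 first.
- exact/measurable_EFinP.
- by move=> x _; rewrite lee_fin sqr_ge0.
rewrite (integral_cst01 (L ^+ 2)%:E) -leeBlDr// -EFinB.
by apply: le_trans; rewrite lee_fin; lra.
Qed.

(** * The implicit solution *)

(** The integral of a nonnegative function is a supremum over simple functions
    below it, and is therefore monotone without any measurability. This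
    is what allows the analysis of the implicit equation to start. *)
Lemma ge0_le_integral_subset {d} {T : measurableType d} {R : realType}
    (nu : {measure set T -> \bar R}) (A B : set T) (f g : T -> \bar R) :
  (forall x, A x -> 0 <= f x)%E -> (forall x, B x -> 0 <= g x)%E ->
  A `<=` B -> (forall x, A x -> f x <= g x)%E ->
  (\int[nu]_(x in A) f x <= \int[nu]_(x in B) g x)%E.
Proof.
move=> f0 g0 AB fg; rewrite (ge0_integralE _ f0) (ge0_integralE _ g0).
apply: ereal_sup_le => _ [h hf <-]; exists h => // x.
apply: (le_trans (hf x)); rewrite !patchE.
case: ifPn => [/set_mem Ax|_]; first by rewrite mem_set; [exact: fg|exact: AB].
by case: ifPn => // /set_mem/g0.
Qed.

(** Precomposing with the projection of the line onto [0,1] reduces this to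
    globally nondecreasing functions. *)
Lemma nondecreasing01_measurable {R : realType} (y : R -> R) :
  {in `[0, 1] &, {homo y : x z / x <= z}} -> measurable_fun (`[0, 1] : set R) y.
Proof.
move=> ynd.
pose c (x : R) := Num.max 0 (Num.min x 1).
have c01 x : c x \in `[0, 1].
  by rewrite in_itv /= /c le_max lexx ge_max ler01 ge_min lexx orbT.
apply: (@eq_measurable_fun _ _ _ _ _ (y \o c)).
  move=> x; rewrite inE /= in_itv /= => /andP[x0 x1].
  by rewrite /c min_l// max_r.
apply: nondecreasing_measurable => // x z xz /=.
apply: ynd; rewrite ?c01// /c ge_max le_max lexx /= le_max.
by apply/orP; right; rewrite le_min !ge_min xz lexx orbT.
Qed.

(** With g = 1 / sqrt(m(y)) and I(x) = int_0^x g, the equation says that y is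
    I / I(1). As g >= 0, the lower integral I is nondecreasing, so y is, so y and
    then g are measurable; g being bounded by 1 / sqrt(m1), I is
    Lipschitz. The argument also covers the degenerate case I(1) = 0, where the
    quotient is 0 by convention. *)
Lemma implicit_within_continuous {R : realType} (m y : R -> R) (m1 : R) :
  0 < m1 -> {within `[0, 1], continuous m} ->
  {in `[0, 1], forall s, m1 <= m s} ->
  implicit_solution m y -> {within `[0, 1], continuous y}.
Proof.
move=> m10 mc m1m [y01 yE].
pose g x := (Num.sqrt (m (y x)))^-1.
pose B := (Num.sqrt m1)^-1.
pose I x := \int[mu]_(s in `[0, x]) g s.
have yI x : x \in `[0, 1] -> y x = I x / I 1 by exact: yE.
have m0 x : x \in `[0, 1] -> 0 < m x by move=> /m1m; exact: lt_le_trans.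
have gB t : t \in `[0, 1] -> 0 <= g t <= B.
  move=> t01; rewrite invr_ge0 sqrtr_ge0 /= lef_pV2 ?posrE ?sqrtr_gt0//.
    by rewrite ler_wsqrtr// m1m// y01.
  exact/m0/y01.
have i0 : (0 : R) \in `[0, 1] by rewrite in_itv /= lexx ler01.
have B0 : 0 <= B by rewrite invr_ge0 sqrtr_ge0.
have sub01 (x t : R) : x <= 1 -> t \in `[0, x] -> t \in `[0, 1].
  by move=> x1; rewrite !in_itv /= => /andP[-> /le_trans]; apply.
have fin x : x <= 1 -> (\int[mu]_(s in `[0%R, x]) (g s)%:E)%E \is a fin_num.
  move=> x1; rewrite ge0_fin_numE; last first.
    by apply: integral_ge0 => t /(sub01 _ _ x1)/gB/andP[]; rewrite lee_fin.
  apply: le_lt_trans (ltry B); rewrite -[leRHS](integral_cst01 B%:E).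
  apply: ge0_le_integral_subset.
  - by move=> t /(sub01 _ _ x1)/gB/andP[]; rewrite lee_fin.
  - by move=> t _; rewrite lee_fin.
  - by move=> t /(sub01 _ _ x1).
  - by move=> t /(sub01 _ _ x1)/gB/andP[_]; rewrite lee_fin.
have Ind x z : x <= z -> z <= 1 -> I x <= I z.
  move=> xz z1; apply: fine_le; [exact: fin (le_trans xz z1)|exact: fin|].
  apply: ge0_le_integral_subset => //.
  - by move=> t /(sub01 _ _ (le_trans xz z1))/gB/andP[]; rewrite lee_fin.
  - by move=> t /(sub01 _ _ z1)/gB/andP[]; rewrite lee_fin.
  - by apply: subset_itvl; rewrite bnd_simp.
have I0 : I 0 = 0 by rewrite /I set_itv1 Rintegral_set1.
have I10 : 0 <= I 1 by rewrite -I0 Ind.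
have my : measurable_fun (`[0, 1] : set R) y.
  apply: nondecreasing01_measurable => x z x01 z01 xz.
  rewrite !yI// ler_wpM2r ?invr_ge0// Ind//.
  by move: z01; rewrite in_itv /= => /andP[].
have mg : measurable_fun (`[0, 1] : set R) g.
  apply: (@measurable_comp _ _ _ _ _ _ (`[0, 1] : set R)
    (fun v => (Num.sqrt (m v))^-1) _ y) => //.
    by move=> _ [x x01 <-]; exact: y01.
  apply: within01_measurable; apply: within_continuous_inv.
    by move=> x /m0; rewrite sqrtr_gt0.
  exact: within_continuous_sqrt.
have intg : mu.-integrable (`[0, 1] : set R) (EFin \o g).
  have mu01 : (mu (`[0%R, 1%R] : set R) < +oo)%E.
    by rewrite lebesgue_measure01 ltry.
  apply: measurable_bounded_integrable => //.
  exists B; split; first by rewrite num_real.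
  move=> M BM x x01; have /andP[g0 gB'] := gB x x01.
  by rewrite /= ger0_norm// (le_trans gB')// ltW.
have ylip x z : 0 <= x -> x <= z -> z <= 1 ->
    `|y z - y x| <= B / I 1 * (z - x).
  move=> x0 xz z1.
  have z01 : z \in `[0, 1] by rewrite in_itv /= z1 (le_trans x0).
  have x01 : x \in `[0, 1] by rewrite in_itv /= x0 (le_trans xz).
  have gxz t : x <= t -> t <= z -> 0 <= g t <= B.
    move=> xt tz; apply: gB.
    by rewrite in_itv /= (le_trans x0 xt) (le_trans tz z1).
  have /andP[_ IB] := Rintegral_increment_bounds g x z 0 B intg x0 xz z1 gxz.
  rewrite !yI// -mulrBl ger0_norm ?divr_ge0 ?subr_ge0 ?Ind//.
  by rewrite mulrAC ler_wpM2r ?invr_ge0.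
apply/subspace_continuousP => x x01; apply/cvgrPdist_le => e e0.
(* The + 1 keeps K positive in the case I 1 = 0. *)
pose K := B / I 1 + 1.
have K0 : 0 < K by rewrite ltr_wpDl// divr_ge0.
apply/nbhs_ballP; exists (e / K) => /=; first by rewrite divr_gt0.
move=> z; rewrite /ball /= => zx z01.
have step : `|y x - y z| <= B / I 1 * `|x - z|.
  move: (x01) (z01); rewrite /= !in_itv /= => /andP[x0 x1] /andP[z0 z1].
  have [xz|/ltW xz] := leP x z.
    by rewrite distrC (ler0_norm (x := x - z)) ?subr_le0// opprB ylip.
  by rewrite (ger0_norm (x := x - z)) ?subr_ge0// ylip.
apply: (le_trans step); apply: (@le_trans _ _ (K * `|x - z|)).
  by rewrite ler_wpM2r// /K lerDl.
by rewrite mulrC -ler_pdivlMr// ltW.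
Qed.

Lemma within_continuous_inv_sqrt {R : realType} (m y : R -> R) (m1 : R) :
  0 < m1 -> {within `[0, 1], continuous m} ->
  {in `[0, 1], forall s, m1 <= m s} -> maps01 y ->
  {within `[0, 1], continuous y} ->
  {within `[0, 1], continuous (fun s => (Num.sqrt (m (y s)))^-1)}.
Proof.
move=> m10 mc m1m y01 yc; apply: within_continuous_inv.
  by move=> x /y01/m1m; rewrite sqrtr_gt0; exact: lt_le_trans.
by apply: within_continuous_sqrt; exact: within_continuous_comp01.
Qed.

(** The derivative of F(y) is sqrt(m(y)) g / I(1) = 1 / I(1), a constant, and
    the value at 1 identifies this constant as F(1). That I(1) is not zero
    holds because otherwise y would vanish identically and g would be a
    nonzero constant. *)
Lemma implicit_explicit {R : realType} (m y : R -> R) (m1 : R) :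
  0 < m1 -> {within `[0, 1], continuous m} ->
  {in `[0, 1], forall s, m1 <= m s} ->
  implicit_solution m y -> explicit_solution m y.
Proof.
move=> m10 mc m1m iy; have [y01 yE] := iy.
have yc := implicit_within_continuous m y m1 m10 mc m1m iy.
have gc := within_continuous_inv_sqrt m y m1 m10 mc m1m y01 yc.
set g := fun s => (Num.sqrt (m (y s)))^-1 in gc.
pose I x := \int[mu]_(s in `[0, x]) g s.
have yI x : x \in `[0, 1] -> y x = (I 1)^-1 * I x.
  by move=> x01; rewrite mulrC; exact: yE.
have Id x : x \in `[0, 1] -> has_derivative01 I x (g x).
  by move=> x01; exact: has_derivative01_Rintegral.
have I0 : I 0 = 0 by rewrite /I set_itv1 Rintegral_set1.
have i0 : (0 : R) \in `[0, 1] by rewrite in_itv /= lexx ler01.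
have i1 : (1 : R) \in `[0, 1] by rewrite in_itv /= lexx ler01.
have sm0 x : x \in `[0, 1] -> Num.sqrt (m (y x)) != 0.
  by move=> /y01/m1m h; rewrite gt_eqF// sqrtr_gt0 (lt_le_trans m10).
have I1 : I 1 != 0.
  apply/eqP => I1.
  have y0 x : x \in `[0, 1] -> y x = 0 by move=> x01; rewrite yI// I1 invr0 mul0r.
  move: I1; rewrite /I (_ : \int[mu]_(s in `[0, 1]) g s =
    \int[mu]_(s in `[0, 1]) g 0); last first.
    by apply: eq_Rintegral => s; rewrite inE => s01; rewrite /g !y0.
  rewrite /Rintegral (integral_cst01 (g 0)%:E) /= => /eqP.
  by rewrite invr_eq0 (negbTE (sm0 0 i0)).
have yd x : x \in `[0, 1] -> has_derivative01 y x ((I 1)^-1 * g x).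
  move=> x01; apply: (eq_has_derivative01 (fun t => (I 1)^-1 * I t)) => //.
    by move=> t t01; rewrite yI.
  by apply: has_derivative01Z; exact: Id.
have Fy : {in `[0, 1], F m \o y =1 (fun x => (I 1)^-1 * x)}.
  apply: (eq_of_derivative01 _ _ (fun=> (I 1)^-1)).
  - move=> x x01.
    have -> : (I 1)^-1 = Num.sqrt (m (y x)) * ((I 1)^-1 * g x).
      by rewrite mulrCA divff ?mulr1 ?sm0.
    apply: has_derivative01_comp (yd x x01) => //.
    by apply: has_derivative01_F => //; exact: y01.
  - move=> x x01; rewrite -[X in has_derivative01 _ _ X]mulr1.
    by apply: has_derivative01Z; exact: has_derivative01_id.
  - have y0 : y 0 = 0 by rewrite (yI 0 i0) I0 mulr0.
    by rewrite /= y0 F0 mulr0.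
split=> // x x01; have := Fy x x01; have := Fy 1 i1.
by rewrite /= mulr1 yI// mulVf// => ->.
Qed.

(** The functions y and F(1) I have the same derivative F(1) g and both
    vanish at 0; evaluating at 1 gives F(1) I(1) = 1. *)
Lemma explicit_implicit {R : realType} (m y : R -> R) (m1 : R) :
  0 < m1 -> {within `[0, 1], continuous m} ->
  {in `[0, 1], forall s, m1 <= m s} ->
  explicit_solution m y -> implicit_solution m y.
Proof.
move=> m10 mc m1m ey; have [y01 yE] := ey.
have yd := has_derivative01_explicit m m1 y m10 mc m1m ey.
have [y0 y1] := explicit_boundary m m1 y m10 mc m1m ey.
have yc := has_derivative01_within_continuous y _ yd.
have gc := within_continuous_inv_sqrt m y m1 m10 mc m1m y01 yc.
set g := fun s => (Num.sqrt (m (y s)))^-1 in gc.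
pose I x := \int[mu]_(s in `[0, x]) g s.
have i1 : (1 : R) \in `[0, 1] by rewrite in_itv /= lexx ler01.
have yI : {in `[0, 1], y =1 (fun x => F m 1 * I x)}.
  apply: (eq_of_derivative01 _ _ _ yd).
    by move=> x x01; apply: has_derivative01Z; exact: has_derivative01_Rintegral.
  by rewrite y0 /I set_itv1 Rintegral_set1 mulr0.
split=> // x x01; rewrite yI// -/g -/(I x) -/(I 1).
have := yI 1 i1; rewrite y1 => LI.
have I1 : I 1 != 0.
  by apply/eqP => I1; move: LI; rewrite I1 mulr0 => /eqP; rewrite oner_eq0.
by apply: (mulIf I1); rewrite divfK// mulrAC -LI mul1r.
Qed.

Theorem theorem2p2 (R : realType) (m1 m2 : R) (m : R -> R)
    (m1_gt0 : 0 < m1) (m1_lt_m2 : m1 < m2)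
    (m_bounds : {in `[0, 1], forall s, m s \in `[m1, m2]})
    (m_continuous : {within `[0, 1], continuous m}) :
  [/\ exists_unique01 (implicit_solution m),
      forall ystar : R -> R, implicit_solution m ystar -> global_minimizer m ystar,
      exists_unique01 (explicit_solution m) &
      forall ystar : R -> R, explicit_solution m ystar -> global_minimizer m ystar].
Proof.
have m1m s : s \in `[0, 1] -> m1 <= m s.
  by move=> /m_bounds; rewrite in_itv /= => /andP[].
have m0 s : s \in `[0, 1] -> 0 <= m s.
  by move=> /m1m; apply: le_trans; exact: ltW.
have explicit_minimizer y : explicit_solution m y -> global_minimizer m y.
  move=> ey; split; last first.
    by move=> z cz; rewrite (J_explicit m m1)//; exact: J_lower_bound.
  have [y0 y1] := explicit_boundary m m1 y m1_gt0 m_continuous m1m ey.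
  split=> //; first by case: ey.
  move=> x x01; have [] := has_derivative01_derive01 y x _ x01
    (has_derivative01_explicit m m1 y m1_gt0 m_continuous m1m ey x x01).
  by [].
have [y [ey uy]] := exists_unique_explicit m m1 m1_gt0 m_continuous m1m.
split; [|by move=> z /(implicit_explicit m z m1 m1_gt0 m_continuous m1m)
  /explicit_minimizer| by exists y |by []].
exists y; split; first exact: (explicit_implicit m y m1).
by move=> z /(implicit_explicit m z m1 m1_gt0 m_continuous m1m)/uy.
Qed.
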